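(* Let $m\in(-1,1)$ be the prescribed mass. For every $\gamma>0$ there exists a number $N_\gamma\in\mathbb{N}$, depending on $\gamma$, such that every axisymmetric pattern $u$ of mass $m$ with $n$ interfaces that is a critical point of $E_\gamma$ satisfies $n\le N_\gamma$.
   Context: For $u\in BV(\mathbb{S}^2;\{\pm1\})$ with $\frac1{4\pi}\int_{\mathbb{S}^2}u\,d\mathcal{H}^2=m$ and $\gamma>0$, the energy is $$E_\gamma(u)=\frac12\int_{\mathbb{S}^2}|\nabla u|+\gamma\int_{\mathbb{S}^2}|\nabla v|^2\,d\mathcal{H}^2,$$ where $\int_{\mathbb{S}^2}|\nabla u|$ is the total variation of $u$, $v$ solves $-\Delta v=u-m$ on $\mathbb{S}^2$ ($\Delta$ is the Laplace--Beltrami operator of the unit sphere, and $v$ is unique up to an additive constant) and $\nabla$ is the gradient on $\mathbb{S}^2$. Functions on $\mathbb{S}^2$ depending only on the polar angle $\phi$ are regarded as functions of $z=\cos\phi\in[-1,1]$. An axisymmetric pattern with $n$ interfaces at $-1=z_0<z_1<\dots<z_n<z_{n+1}=1$ is the function $u$ with $u=(-1)^{k+1}$ on $[z_k,z_{k+1})$ for $k=0,\dots,n$; its mass is $\frac1{4\pi}\int_{\mathbb{S}^2}u\,d\mathcal{H}^2=\frac12\sum_{k=1}^{n+1}(-1)^k(z_k-z_{k-1})$. For such $u$, $v$ is also a function of $z$. Such a pattern is a critical point of $E_\gamma$ if it satisfies the Euler--Lagrange equation: there is a constant $\lambda$ with $\kappa_g(z_k)+4\gamma v(z_k)=\lambda$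 for all $k=1,\dots,n$, where $\kappa_g(z_k)$ is the signed geodesic curvature of the circle $\{z=z_k\}$ with respect to the normal pointing out of $\{u=1\}$, i.e. $\kappa_g(z_k)=(-1)^{k+1}z_k/\sqrt{1-z_k^2}$. *)

(* Defs.v *)
(* Stdlib reals with Coquelicot. *)
From Stdlib Require Import Reals.
From Coquelicot Require Import Coquelicot.
Open Scope R_scope.

Definition R3 : Type := (R * R * R)%type.

Definition dot (p q : R3) : R :=
  let '(p1, p2, p3) := p in let '(q1, q2, q3) := q in
  p1 * q1 + p2 * q2 + p3 * q3.

Definition norm3 (p : R3) : R := sqrt (dot p p).

Definition ex_partials (F : R3 -> R) (p : R3) : Prop :=
  let '(p1, p2, p3) := p in
  ex_derive (fun t => F (t, p2, p3)) p1 /\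
  ex_derive (fun t => F (p1, t, p3)) p2 /\
  ex_derive (fun t => F (p1, p2, t)) p3.

Definition grad (F : R3 -> R) (p : R3) : R3 :=
  let '(p1, p2, p3) := p in
  (Derive (fun t => F (t, p2, p3)) p1,
   Derive (fun t => F (p1, t, p3)) p2,
   Derive (fun t => F (p1, p2, t)) p3).

(* A function on the unit sphere is given by a function on [R3] of which only
   the values at unit vectors matter.  Calculus on the sphere is that of the
   extension which is constant along rays; at a unit vector the Euclidean
   gradient of this extension is tangent to the sphere and equals the
   Riemannian gradient. *)
Definition radial_ext (f : R3 -> R) (p : R3) : R :=
  let '(p1, p2, p3) := p in
  f (p1 / norm3 p, p2 / norm3 p, p3 / norm3 p).

Definition sphere_C1 (f : R3 -> R) : Prop :=
  forall p : R3, p <> (0, 0, 0) ->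
    ex_partials (radial_ext f) p /\
    continuous (grad (radial_ext f) : R * R * R -> R * R * R) p.

Definition sphere_grad (f : R3 -> R) (p : R3) : R3 := grad (radial_ext f) p.

(* Integral against the area measure of the unit sphere: in the coordinates
   z = cos (polar angle) and theta = longitude, this measure is dz dtheta. *)
Definition sphere_int (f : R3 -> R) : R :=
  RInt (fun z =>
    RInt (fun theta =>
      f (sqrt (1 - z ^ 2) * cos theta, sqrt (1 - z ^ 2) * sin theta, z))
    0 (2 * PI)) (-1) 1.

Definition axisym (g : R -> R) (p : R3) : R := g (snd p).

Definition mass (u : R3 -> R) : R := / (4 * PI) * sphere_int u.

(* - Delta v = u - m on the sphere.  As u jumps, the equation is understood
   weakly; its solutions for bounded u are C^1 by elliptic regularity, so the
   continuous representative, which the Euler-Lagrange equation evaluates, is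
   also C^1. *)
Definition solves_poisson (m : R) (u v : R3 -> R) : Prop :=
  sphere_C1 v /\
  forall phi : R3 -> R, sphere_C1 phi ->
    sphere_int (fun p => dot (sphere_grad v p) (sphere_grad phi p)) =
    sphere_int (fun p => (u p - m) * phi p).

(* [z 1, ..., z n] are the interfaces; [z] is irrelevant beyond [n + 1].  The
   value of [u] at 1, that is at the north pole, is left free. *)
Definition is_pattern (n : nat) (z : nat -> R) (u : R -> R) : Prop :=
  z 0%nat = -1 /\ z (n + 1)%nat = 1 /\
  (forall k, (k <= n)%nat -> z k < z (k + 1)%nat) /\
  (forall k x, (k <= n)%nat -> z k <= x < z (k + 1)%nat ->
     u x = (-1) ^ (k + 1)).

(* Signed geodesic curvature of the circle of height [z k], with respect to the
   normal pointing out of the region where u = 1. *)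
Definition geodesic_curvature (z : nat -> R) (k : nat) : R :=
  (-1) ^ (k + 1) * (z k / sqrt (1 - z k ^ 2)).

Definition is_critical (gamma m : R) (n : nat) (z : nat -> R) (u : R -> R)
    : Prop :=
  exists v : R -> R,
    solves_poisson m (axisym u) (axisym v) /\
    exists lambda : R, forall k, (1 <= k <= n)%nat ->
      geodesic_curvature z k + 4 * gamma * v (z k) = lambda.

(* Main.v *)
Require Import Defs.
From Stdlib Require Import Reals Lra Lia.
From Coquelicot Require Import Coquelicot.
Open Scope R_scope.

(** For a function of the height [z] alone, the Poisson equation is the ordinary
    differential equation [- ((1 - z^2) v')' = u - m].  It integrates once to
    [(1 - z^2) v' = - W], where [W] is the primitive of [u - m] vanishing at the
    south pole ([pattern_first_integral]).  Since [u] is [1] or [-1] and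
    [-1 < m < 1], the function [W] is 2-Lipschitz, whatever the pattern.

    In the Euler-Lagrange equation the curvature term [z / sqrt (1 - z^2)]
    carries a sign that alternates from one interface to the next, so it is the
    same at [z k] and [z (k + 2)].  By Rolle's theorem the function
    [s * z / sqrt (1 - z^2) + 4 gamma v(z)], with [s = (-1)^(k + 1)], has a
    critical point [xi] between these two interfaces.  As the derivative of
    [z / sqrt (1 - z^2)] is [(1 - z^2)^(-3/2)], multiplying by [1 - xi^2] turns
    this into [s / sqrt (1 - xi^2) = 4 gamma W(xi)] ([critical_flux]): both
    degenerations at the poles disappear, and [4 gamma W(xi)] has the sign of
    [s] and absolute value at least 1.

    The same argument between [z (k + 1)] and [z (k + 3)] gives a point at which
    [4 gamma W] has the opposite sign and absolute value at least 1.  The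
    Lipschitz bound then forces
    [4 gamma (z (k + 3) - z k) >= 1] ([three_interface_gap]), and only boundedly
    many such gaps fit into the interval from -1 to 1.

    The first integral is extracted from the weak equation as follows.  The
    product [(1 - z^2) v'] is the vertical component of the gradient along a
    meridian, so it extends to a function [flux v] continuous up to the poles.
    Testing with a primitive of [flux v + W] and integrating by parts on each
    interval between interfaces gives [int (flux v + W)^2 = 0]. *)

(** * Continuity and integration on the line *)

Lemma continuous_pair {T U V : UniformSpace} (f : T -> U) (g : T -> V) (x : T) :
  continuous f x -> continuous g x -> continuous (fun t => (f t, g t)) x.
Proof.
intros Hf Hg P [eps HP].
change (locally x (fun t => P (f t, g t))).
apply (filter_imp (fun t => ball (f x) eps (f t) /\ ball (g x) eps (g t))).
- intros t [Ht1 Ht2]; apply HP; now split.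
- apply filter_and; [apply Hf | apply Hg]; apply locally_ball.
Qed.

Lemma continuous_mult_R {U : UniformSpace} (f g : U -> R) (x : U) :
  continuous f x -> continuous g x -> continuous (fun t => f t * g t) x.
Proof. intros; now apply (continuous_mult f g). Qed.

Lemma continuous_plus_R {U : UniformSpace} (f g : U -> R) (x : U) :
  continuous f x -> continuous g x -> continuous (fun t => f t + g t) x.
Proof. intros; now apply (continuous_plus f g). Qed.

Lemma continuous_opp_R {U : UniformSpace} (f : U -> R) (x : U) :
  continuous f x -> continuous (fun t => - f t) x.
Proof. intros; now apply (continuous_opp f). Qed.

Lemma ex_RInt_continuous_all (h : R -> R) (a b : R) :
  (forall x, continuous h x) -> ex_RInt h a b.
Proof. intros Hh; apply (ex_RInt_continuous (V := R_CompleteNormedModule)); auto. Qed.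

Lemma RInt_lipschitz (f : R -> R) (M o : R) :
  (forall a b, ex_RInt f a b) -> (forall x, Rabs (f x) <= M) ->
  forall a b, Rabs (RInt f o b - RInt f o a) <= M * Rabs (b - a).
Proof.
intros Hf HM.
assert (H : forall a b, a <= b ->
  Rabs (RInt f o b - RInt f o a) <= M * Rabs (b - a)).
{ intros a b Hab.
  assert (E := RInt_Chasles f o a b (Hf _ _) (Hf _ _)).
  change (RInt f o a + RInt f a b = RInt f o b) in E; rewrite <- E.
  rewrite Rplus_minus_l.
  rewrite (Rabs_pos_eq (b - a)), Rmult_comm by lra.
  now apply abs_RInt_le_const. }
intros a b; destruct (Rle_dec a b) as [Hab|Hab]; [now apply H|].
rewrite Rabs_minus_sym, (Rabs_minus_sym b); apply H; lra.
Qed.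

Lemma lipschitz_continuous (W : R -> R) (M : R) :
  (forall a b, Rabs (W b - W a) <= M * Rabs (b - a)) ->
  forall x, continuous W x.
Proof.
intros HW x; apply filterlim_locally; intros eps.
assert (HM : 0 < Rabs M + 1) by (generalize (Rabs_pos M); lra).
assert (He : 0 < eps / (Rabs M + 1)) by (apply Rdiv_lt_0_compat; [apply eps|lra]).
exists (mkposreal _ He); intros y Hy.
change (Rabs (y - x) < eps / (Rabs M + 1)) in Hy.
change (Rabs (W y - W x) < eps).
apply Rle_lt_trans with (1 := HW x y).
apply Rle_lt_trans with ((Rabs M + 1) * Rabs (y - x)).
- apply Rmult_le_compat_r; [apply Rabs_pos|].
  generalize (Rle_abs M); lra.
- apply Rmult_lt_compat_l with (1 := HM) in Hy.
  replace ((Rabs M + 1) * (eps / (Rabs M + 1))) with (pos eps) in Hy by (field; lra).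
  exact Hy.
Qed.

(** The primitive of [h^2] is nondecreasing with equal values at both ends, hence
    constant, so its derivative [h^2] vanishes. *)
Lemma RInt_sqr_eq0 (h : R -> R) (a b : R) : (forall x, continuous h x) ->
  RInt (fun x => h x * h x) a b = 0 -> forall x, a < x < b -> h x = 0.
Proof.
intros Hh H0 x Hx.
set (q := fun x => h x * h x) in *.
assert (Hq : forall y, continuous q y) by (intros; now apply continuous_mult_R).
assert (Hex : forall c d, ex_RInt q c d) by (intros; now apply ex_RInt_continuous_all).
assert (Hpos : forall c d, c <= d -> 0 <= RInt q c d).
{ intros c d Hcd; apply RInt_ge_0; auto; intros; apply Rle_0_sqr. }
assert (Hz : forall y, a < y < b -> RInt q a y = 0).
{ intros y Hy.
  assert (E := RInt_Chasles q a y b (Hex _ _) (Hex _ _)).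
  change (RInt q a y + RInt q y b = RInt q a b) in E.
  generalize (Hpos a y ltac:(lra)) (Hpos y b ltac:(lra)); lra. }
assert (Hd : is_derive (fun y => RInt q a y) x (q x)).
{ apply (is_derive_RInt q (fun y => RInt q a y) a); auto.
  apply filter_forall; intros y; now apply (RInt_correct (V := R_CompleteNormedModule)). }
assert (Hd0 : is_derive (fun y => RInt q a y) x 0).
{ apply is_derive_ext_loc with (fun _ => 0); [|apply (is_derive_const 0)].
  assert (Hloc : locally x (fun y => a < y < b)).
  { now apply (open_and _ _ (open_gt a) (open_lt b)). }
  revert Hloc; apply filter_imp; intros y Hy; now rewrite Hz. }
assert (E := is_derive_unique _ _ _ Hd).
rewrite (is_derive_unique _ _ _ Hd0) in E; unfold q in E.
destruct (Rmult_integral _ _ (eq_sym E)); auto.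
Qed.

(** Integration by parts against a step function [f], in the form
    [int (f psi + W psi') = W psi] at the ends: [W psi] is differentiable only
    between jumps, so the fundamental theorem of calculus is applied on each
    interval of constancy, where [W] is affine, and the boundary terms
    telescope. *)
Lemma is_RInt_step_by_parts (f W psi w : R -> R) (z c : nat -> R)
    (n : nat) :
  (forall k, (k <= n)%nat -> z k <= z (k + 1)%nat) ->
  (forall k x, (k <= n)%nat -> z k < x < z (k + 1)%nat -> f x = c k) ->
  (forall a b, is_RInt f a b (W b - W a)) ->
  (forall x, is_derive psi x (w x)) -> (forall x, continuous w x) ->
  forall k, (k <= n + 1)%nat ->
  is_RInt (fun x => f x * psi x + W x * w x) (z 0%nat) (z k)
    (W (z k) * psi (z k) - W (z 0%nat) * psi (z 0%nat)).
Proof.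
intros Hz Hf HW Hpsi Hw.
induction k as [|k IH]; intros Hk.
{ rewrite Rminus_diag; apply (is_RInt_point (fun x => f x * psi x + W x * w x)). }
assert (Hkn : (k <= n)%nat) by lia.
assert (Hzk := Hz k Hkn); replace (S k) with (k + 1)%nat by lia.
set (a := z k) in *; set (b := z (k + 1)%nat) in *.
assert (HWa : forall x, a <= x <= b -> W x = W a + c k * (x - a)).
{ intros x Hx.
  assert (E : is_RInt f a x (scal (x - a) (c k))).
  { apply is_RInt_ext with (fun _ => c k); [|apply (is_RInt_const (V := R_NormedModule))].
    rewrite Rmin_left, Rmax_right by lra; intros y Hy.
    symmetry; apply Hf; auto; fold a b; lra. }
  assert (E' : W x - W a = (x - a) * c k).
  { rewrite <- (is_RInt_unique (V := R_CompleteNormedModule) f a x _ (HW a x)).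
    exact (is_RInt_unique (V := R_CompleteNormedModule) f a x _ E). }
  lra. }
replace (W b * psi b - W (z 0%nat) * psi (z 0%nat)) with
  (plus (W a * psi a - W (z 0%nat) * psi (z 0%nat)) (W b * psi b - W a * psi a))
  by (unfold plus; simpl; ring).
apply (is_RInt_Chasles (V := R_NormedModule)) with a; [apply IH; lia|].
set (A := fun x => W a + c k * (x - a)).
apply is_RInt_ext with (fun x => c k * psi x + A x * w x).
{ rewrite Rmin_left, Rmax_right by lra; intros x Hx.
  rewrite (Hf k x) by auto. now rewrite HWa by lra. }
replace (W a * psi a) with (A a * psi a) by (unfold A; ring).
replace (W b * psi b) with (A b * psi b) by (unfold A; now rewrite (HWa b) by lra).
apply (is_RInt_derive (V := R_CompleteNormedModule) (fun x => A x * psi x)).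
- intros x _.
  apply (is_derive_mult A psi x (c k) (w x)); [|apply Hpsi|intros; apply Rmult_comm].
  unfold A; auto_derive; auto; ring.
- intros x _.
  assert (HA : continuous A x).
  { apply (ex_derive_continuous (V := R_NormedModule)).
    unfold A; auto_derive; auto. }
  assert (Hpc : continuous psi x).
  { apply (ex_derive_continuous (V := R_NormedModule)); eexists; apply Hpsi. }
  apply continuous_plus_R; apply continuous_mult_R; auto.
  apply continuous_const.
Qed.

Lemma ex_RInt_step (f : R -> R) (z c : nat -> R) (n : nat) :
  (forall k, (k <= n)%nat -> z k <= z (k + 1)%nat) ->
  (forall k x, (k <= n)%nat -> z k < x < z (k + 1)%nat -> f x = c k) ->
  forall k, (k <= n + 1)%nat -> ex_RInt f (z 0%nat) (z k).
Proof.
intros Hz Hf; induction k as [|k IH]; intros Hk.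
{ apply (ex_RInt_point (V := R_NormedModule)). }
apply (ex_RInt_Chasles (V := R_NormedModule)) with (z k); [apply IH; lia|].
replace (S k) with (k + 1)%nat by lia.
assert (Hzk := Hz k ltac:(lia)).
apply ex_RInt_ext with (fun _ => c k); [|apply (ex_RInt_const (V := R_NormedModule))].
rewrite Rmin_left, Rmax_right by lra; intros y Hy.
symmetry; apply Hf; auto; lia.
Qed.

Lemma ex_RInt_cutoff (f : R -> R) (a b : R) : a <= b ->
  (forall x, x < a -> f x = 0) -> (forall x, b < x -> f x = 0) ->
  ex_RInt f a b -> forall c d, ex_RInt f c d.
Proof.
intros Hab Hl Hr Hf.
assert (H : forall x, ex_RInt f a x).
{ intros x; destruct (Rle_dec x a) as [Hx|Hx].
  { apply ex_RInt_ext with (fun _ => 0); [|apply (ex_RInt_const (V := R_NormedModule))].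
    rewrite Rmin_right, Rmax_left by lra; intros y Hy; rewrite Hl; lra. }
  destruct (Rle_dec x b) as [Hxb|Hxb].
  { apply (ex_RInt_Chasles_1 (V := R_CompleteNormedModule)) with b; auto; lra. }
  apply (ex_RInt_Chasles (V := R_NormedModule)) with b; auto.
  apply ex_RInt_ext with (fun _ => 0); [|apply (ex_RInt_const (V := R_NormedModule))].
  rewrite Rmin_left, Rmax_right by lra; intros y Hy; rewrite Hr; lra. }
intros c d; apply (ex_RInt_Chasles (V := R_NormedModule)) with a; auto.
apply (ex_RInt_swap (V := R_NormedModule)); auto.
Qed.

(** * Axisymmetric functions on the sphere *)

(** The radial extension of [axisym psi] is [psi] composed with this function. *)
Definition height (p : R3) : R := snd p / norm3 p.

Lemma dot_self_pos (a b c : R) : (a, b, c) <> (0, 0, 0) :> R3 ->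
  0 < a * a + b * b + c * c.
Proof.
intros Hp.
destruct (Req_dec a 0) as [Ha|Ha]; [|nra].
destruct (Req_dec b 0) as [Hb|Hb]; [|nra].
destruct (Req_dec c 0) as [Hc|Hc]; [|nra].
now subst.
Qed.

Definition height_grad (p : R3) : R3 :=
  let '(a, b, c) := p in
  let r3 := norm3 p ^ 3 in
  (- (a * c) / r3, - (b * c) / r3, (a * a + b * b) / r3).

Lemma is_derive_height (a b c : R) : (a, b, c) <> (0, 0, 0) :> R3 ->
  is_derive (fun t => height (t, b, c)) a (fst (fst (height_grad (a, b, c)))) /\
  is_derive (fun t => height (a, t, c)) b (snd (fst (height_grad (a, b, c)))) /\
  is_derive (fun t => height (a, b, t)) c (snd (height_grad (a, b, c))).
Proof.
intros Hp; apply dot_self_pos in Hp.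
assert (Hs := sqrt_lt_R0 _ Hp).
assert (Hq := sqrt_sqrt _ (Rlt_le _ _ Hp)).
unfold height, height_grad, norm3, dot; cbn [fst snd].
split; [|split]; (auto_derive; [repeat split; auto; lra|]).
all: set (s := sqrt _) in *.
all: field_simplify_eq; [|lra].
- ring.
- ring.
- replace (s ^ 2) with (a * a + b * b + c * c) by (rewrite <- Hq; ring). ring.
Qed.

Lemma is_derive_radial_axisym (psi : R -> R) (w a b c : R) :
  (a, b, c) <> (0, 0, 0) :> R3 ->
  is_derive psi (height (a, b, c)) w ->
  let G := height_grad (a, b, c) in
  is_derive (fun t => radial_ext (axisym psi) (t, b, c)) a (fst (fst G) * w) /\
  is_derive (fun t => radial_ext (axisym psi) (a, t, c)) b (snd (fst G) * w) /\
  is_derive (fun t => radial_ext (axisym psi) (a, b, t)) c (snd G * w).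
Proof.
intros Hp Hw G.
destruct (is_derive_height a b c Hp) as (H1 & H2 & H3).
split; [|split].
- exact (is_derive_comp psi (fun t => height (t, b, c)) a _ _ Hw H1).
- exact (is_derive_comp psi (fun t => height (a, t, c)) b _ _ Hw H2).
- exact (is_derive_comp psi (fun t => height (a, b, t)) c _ _ Hw H3).
Qed.

Lemma grad_radial_axisym (psi : R -> R) (w a b c : R) :
  (a, b, c) <> (0, 0, 0) :> R3 ->
  is_derive psi (height (a, b, c)) w ->
  let G := height_grad (a, b, c) in
  grad (radial_ext (axisym psi)) (a, b, c) =
  (fst (fst G) * w, snd (fst G) * w, snd G * w).
Proof.
intros Hp Hw G.
destruct (is_derive_radial_axisym psi w a b c Hp Hw) as (H1 & H2 & H3).
unfold grad; f_equal; [f_equal|]; now apply is_derive_unique.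
Qed.

Lemma continuous_coord (p : R3) :
  continuous (fun q : R * R * R => fst (fst q)) p /\
  continuous (fun q : R * R * R => snd (fst q)) p /\
  continuous (fun q : R * R * R => snd q) p.
Proof.
destruct p as [[a b] c]; repeat split.
- apply (continuous_comp (fst : R * R * R -> R * R) fst); apply continuous_fst.
- apply (continuous_comp (fst : R * R * R -> R * R) snd).
  apply continuous_fst. apply continuous_snd.
- apply continuous_snd.
Qed.

Lemma continuous_norm3 (p : R3) : continuous (norm3 : R * R * R -> R) p.
Proof.
destruct (continuous_coord p) as (H1 & H2 & H3).
apply (continuous_ext (fun q : R * R * R => sqrt (fst (fst q) * fst (fst q)
  + snd (fst q) * snd (fst q) + snd q * snd q))).
{ now intros [[a b] c]. }
apply (continuous_comp (fun q : R * R * R => fst (fst q) * fst (fst q)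
  + snd (fst q) * snd (fst q) + snd q * snd q) sqrt); [|apply continuous_sqrt].
repeat apply continuous_plus_R; now apply continuous_mult_R.
Qed.

Lemma norm3_pos (p : R3) : p <> (0, 0, 0) -> 0 < norm3 p.
Proof.
destruct p as [[a b] c]; intros Hp; apply sqrt_lt_R0.
now apply dot_self_pos.
Qed.

Lemma norm3_neq0 (p : R3) : 0 < norm3 p -> p <> (0, 0, 0).
Proof.
intros Hp E; rewrite E in Hp; revert Hp; unfold norm3, dot.
replace (0 * 0 + 0 * 0 + 0 * 0) with 0 by ring. rewrite sqrt_0; lra.
Qed.

Lemma locally_norm3_pos (p : R3) : p <> (0, 0, 0) ->
  locally (p : R * R * R) (fun q => 0 < norm3 q).
Proof.
intros Hp.
apply (continuous_norm3 p (fun r => 0 < r)).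
now apply (open_gt 0), norm3_pos.
Qed.

(** Functions of the height are admissible test functions in the weak equation;
    since [psi] is C^1 on a neighbourhood of [[-1, 1]], the chain rule applies at
    the poles as well. *)
Lemma sphere_C1_axisym (psi w : R -> R) :
  (forall x, is_derive psi x (w x)) -> (forall x, continuous w x) ->
  sphere_C1 (axisym psi).
Proof.
intros Hd Hw p Hp; split.
{ destruct p as [[a b] c].
  destruct (is_derive_radial_axisym psi _ a b c Hp (Hd _)) as (H1 & H2 & H3).
  repeat split; eexists; eassumption. }
destruct (continuous_coord p) as (C1 & C2 & C3).
assert (Hn := norm3_pos p Hp).
assert (Ci : continuous (fun q : R * R * R => / norm3 q) p).
{ apply (continuous_comp (norm3 : R * R * R -> R) Rinv).
  apply continuous_norm3. apply continuous_Rinv; lra. }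
assert (Cw : continuous (fun q : R * R * R => w (height q)) p).
{ apply (continuous_comp (height : R * R * R -> R) w); [|apply Hw].
  now apply continuous_mult_R. }
assert (C3i : continuous (fun q : R * R * R => / norm3 q ^ 3) p).
{ apply (continuous_ext (fun q : R * R * R =>
    / norm3 q * (/ norm3 q * (/ norm3 q)))).
  { intros q; transitivity ((/ norm3 q) ^ 3); [|apply pow_inv].
    now simpl; rewrite Rmult_1_r. }
  now repeat apply continuous_mult_R. }
apply continuous_ext_loc with (g := fun q : R * R * R =>
  (- (fst (fst q) * snd q) * / norm3 q ^ 3 * w (height q),
   - (snd (fst q) * snd q) * / norm3 q ^ 3 * w (height q),
   (fst (fst q) * fst (fst q) + snd (fst q) * snd (fst q)) * / norm3 q ^ 3
     * w (height q))).
{ generalize (locally_norm3_pos p Hp); apply filter_imp; intros [[a b] c] Hq.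
  assert (Hq0 := norm3_neq0 _ Hq).
  refine (eq_sym (eq_trans (grad_radial_axisym psi _ a b c Hq0 (Hd _)) _)).
  unfold height_grad, Rdiv; cbn [fst snd].
  reflexivity. }
repeat apply continuous_pair;
  repeat first [assumption | apply continuous_const | apply continuous_mult_R
    | apply continuous_plus_R | apply continuous_opp_R].
Qed.

(** For [z] outside [[-1, 1]] the square root is 0 and the curve continues along
    the polar axis; thus it is continuous on the whole line and never meets the
    origin. *)
Definition meridian (z : R) : R3 := (sqrt (1 - z ^ 2), 0, z).

Lemma meridian_neq0 (z : R) : meridian z <> (0, 0, 0).
Proof.
unfold meridian; intros E; injection E as E1 E2; rewrite E2 in E1.
replace (1 - 0 * (0 * 1)) with 1 in E1 by ring; rewrite sqrt_1 in E1; lra.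
Qed.

Lemma continuous_meridian (z : R) : continuous (meridian : R -> R * R * R) z.
Proof.
apply continuous_pair; [apply continuous_pair|].
- apply (continuous_comp (fun x => 1 - x ^ 2) sqrt); [|apply continuous_sqrt].
  apply (ex_derive_continuous (V := R_NormedModule) (fun x => 1 - x ^ 2)).
  auto_derive; auto.
- apply continuous_const.
- apply continuous_id.
Qed.

Lemma norm3_circle (z theta : R) : -1 <= z <= 1 ->
  norm3 (sqrt (1 - z ^ 2) * cos theta, sqrt (1 - z ^ 2) * sin theta, z) = 1.
Proof.
intros Hz; unfold norm3, dot.
assert (Hq := sqrt_sqrt (1 - z ^ 2) ltac:(nra)).
assert (Ht := sin2_cos2 theta); unfold Rsqr in Ht.
set (s := sqrt (1 - z ^ 2)) in *.
replace (s * cos theta * (s * cos theta) + s * sin theta * (s * sin theta) + z * z)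
  with (s * s * (sin theta * sin theta + cos theta * cos theta) + z * z) by ring.
rewrite Ht, Hq.
replace ((1 - z ^ 2) * 1 + z * z) with 1 by ring; apply sqrt_1.
Qed.

(** The gradient of a function [psi(z)] at height [z] is [psi'(z)] times the
    tangential part of the vertical unit vector, whose squared length is
    [1 - z^2]. *)
Lemma dot_sphere_grad_axisym (v psi : R -> R) (dv w z theta : R) : -1 < z < 1 ->
  is_derive v z dv -> is_derive psi z w ->
  let p := (sqrt (1 - z ^ 2) * cos theta, sqrt (1 - z ^ 2) * sin theta, z) in
  dot (sphere_grad (axisym v) p) (sphere_grad (axisym psi) p)
  = (1 - z ^ 2) * dv * w.
Proof.
intros Hz Hv Hpsi p.
assert (Hn : norm3 p = 1) by (apply norm3_circle; lra).
assert (Hh : height p = z) by (unfold height; rewrite Hn; simpl; field).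
assert (Hp : p <> (0, 0, 0)) by (apply norm3_neq0; lra).
assert (Hq := sqrt_sqrt (1 - z ^ 2) ltac:(nra)).
assert (Ht := sin2_cos2 theta); unfold Rsqr in Ht.
rewrite <- Hh in Hv, Hpsi.
unfold p, sphere_grad in *.
rewrite (grad_radial_axisym v dv _ _ _ Hp Hv),
  (grad_radial_axisym psi w _ _ _ Hp Hpsi).
unfold height_grad, dot; rewrite Hn; cbn [fst snd].
set (s := sqrt (1 - z ^ 2)) in *; set (C := cos theta) in *; set (S := sin theta) in *.
transitivity ((s * s * (S * S + C * C)) * (z * z + s * s * (S * S + C * C)) * dv * w);
  [field|].
rewrite Ht, Hq; ring.
Qed.

(** On the vertical line over [(1, 0)] the radial extension of [axisym v] is
    [t |-> v (t / sqrt (1 + t^2))].  It is differentiable, and the substitution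
    [t = x / sqrt (1 - x^2)] recovers [v]. *)
Lemma ex_derive_profile (v : R -> R) (z : R) : sphere_C1 (axisym v) ->
  -1 < z < 1 -> ex_derive v z.
Proof.
intros Hv Hz.
set (t0 := z / sqrt (1 - z ^ 2)).
assert (Hp : (1, 0, t0) <> (0, 0, 0) :> R3) by (intros E; injection E; lra).
destruct (proj1 (Hv _ Hp)) as (_ & _ & H3).
apply ex_derive_ext_loc with
  (fun x => radial_ext (axisym v) (1, 0, x / sqrt (1 - x ^ 2))).
- assert (Hloc : locally z (fun x => -1 < x < 1)).
  { apply (open_and _ _ (open_gt (-1)) (open_lt 1)); lra. }
  revert Hloc; apply filter_imp; intros x Hx.
  unfold radial_ext, axisym, norm3, dot; cbn [snd]; f_equal.
  assert (H0 : 0 < 1 - x ^ 2) by nra.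
  assert (Hs := sqrt_lt_R0 _ H0).
  assert (Hq := sqrt_sqrt _ (Rlt_le _ _ H0)).
  set (s := sqrt (1 - x ^ 2)) in *.
  replace (1 * 1 + 0 * 0 + x / s * (x / s)) with (Rsqr (/ s)).
  + rewrite sqrt_Rsqr; [field; lra|]. left; now apply Rinv_0_lt_compat.
  + unfold Rsqr; field_simplify_eq; [nra|lra].
- apply (ex_derive_comp (fun t => radial_ext (axisym v) (1, 0, t))
    (fun x => x / sqrt (1 - x ^ 2))); [exact H3|].
  assert (H0 : 0 < 1 - z ^ 2) by nra.
  assert (Hs := sqrt_lt_R0 _ H0).
  auto_derive. replace (1 + - (z * (z * 1))) with (1 - z ^ 2) by ring.
  repeat split; try lra; now apply Rgt_not_eq.
Qed.

(** This is [(1 - z^2) v'(z)] inside (-1, 1), by [flux_eq].  Written through the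
    gradient on the sphere it is continuous on the whole line, which the formula
    in terms of [v'] would not show at the poles. *)
Definition flux (v : R -> R) (z : R) : R :=
  snd (sphere_grad (axisym v) (meridian z)).

Lemma continuous_flux (v : R -> R) (z : R) : sphere_C1 (axisym v) ->
  continuous (flux v) z.
Proof.
intros Hv.
apply (continuous_comp (fun z => sphere_grad (axisym v) (meridian z) : R * R * R) snd).
- apply (continuous_comp (meridian : R -> R * R * R)
    (sphere_grad (axisym v) : R * R * R -> R * R * R)).
  + apply continuous_meridian.
  + apply Hv, meridian_neq0.
- apply continuous_coord.
Qed.

Lemma flux_eq (v : R -> R) (z : R) : sphere_C1 (axisym v) -> -1 < z < 1 ->
  flux v z = (1 - z ^ 2) * Derive v z.
Proof.
intros Hv Hz.
assert (Hn := norm3_circle z 0 ltac:(lra)).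
rewrite cos_0, sin_0, Rmult_1_r, Rmult_0_r in Hn.
change (norm3 (meridian z) = 1) in Hn.
assert (Hh : height (meridian z) = z) by (unfold height; rewrite Hn; simpl; field).
assert (Hd := Derive_correct v z (ex_derive_profile v z Hv Hz)).
rewrite <- Hh in Hd at 1.
unfold flux, sphere_grad, meridian in *.
rewrite (grad_radial_axisym v _ _ _ _ (meridian_neq0 z) Hd).
unfold height_grad; rewrite Hn; cbn [snd].
rewrite (sqrt_sqrt (1 - z ^ 2)) by nra. field.
Qed.

(** * The Poisson equation for a pattern *)

Lemma sphere_int_zonal (F : R3 -> R) (h : R -> R) :
  (forall z theta, -1 < z < 1 ->
    F (sqrt (1 - z ^ 2) * cos theta, sqrt (1 - z ^ 2) * sin theta, z) = h z) ->
  ex_RInt h (-1) 1 ->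
  sphere_int F = 2 * PI * RInt h (-1) 1.
Proof.
intros HF Hh; unfold sphere_int.
rewrite (RInt_ext _ (fun z => scal (2 * PI) (h z))).
- now rewrite (RInt_scal h).
- rewrite Rmin_left, Rmax_right by lra; intros z Hz.
  rewrite (RInt_ext _ (fun _ => h z)) by (intros; now apply HF).
  rewrite RInt_const; now rewrite Rminus_0_r.
Qed.

(** The weak form of [- ((1 - x^2) v')' = u - m]: for functions of the height
    alone, the longitude contributes the factor [2 PI] on both sides. *)
Lemma zonal_weak_equation (m : R) (u v psi w : R -> R) :
  solves_poisson m (axisym u) (axisym v) ->
  (forall x, is_derive psi x (w x)) -> (forall x, continuous w x) ->
  ex_RInt (fun x => (u x - m) * psi x) (-1) 1 ->
  RInt (fun x => flux v x * w x) (-1) 1 =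
  RInt (fun x => (u x - m) * psi x) (-1) 1.
Proof.
intros [Hv Heq] Hpsi Hw Hu.
generalize (Heq (axisym psi) (sphere_C1_axisym psi w Hpsi Hw)).
rewrite (sphere_int_zonal _ (fun x => flux v x * w x)).
- rewrite (sphere_int_zonal _ (fun x => (u x - m) * psi x)); auto.
  assert (HPI := PI_RGT_0).
  intros E; apply Rmult_eq_reg_l with (2 * PI); [exact E|lra].
- intros z theta Hz; rewrite (flux_eq v z Hv Hz).
  apply dot_sphere_grad_axisym; auto.
  now apply Derive_correct, ex_derive_profile.
- apply ex_RInt_continuous_all; intros x; apply continuous_mult_R; auto.
  now apply continuous_flux.
Qed.

Lemma pattern_covers (n : nat) (z : nat -> R) (u : R -> R) (x : R) :
  is_pattern n z u -> -1 <= x < 1 ->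
  exists k, (k <= n)%nat /\ z k <= x < z (k + 1)%nat.
Proof.
intros (Hz0 & Hz1 & Hz & _) Hx.
assert (H : forall j, (j <= n + 1)%nat -> x < z j ->
  exists k, (k <= n)%nat /\ z k <= x < z (k + 1)%nat).
{ induction j as [|j IH]; intros Hj Hxj; [lra|].
  destruct (Rlt_dec x (z j)) as [Hlt|Hge]; [apply IH; auto; lia|].
  exists j; replace (j + 1)%nat with (S j) by lia; split; [lia|lra]. }
apply (H (n + 1)%nat); [lia|lra].
Qed.

Lemma pattern_lt (n : nat) (z : nat -> R) (u : R -> R) (j k : nat) :
  is_pattern n z u -> (j < k <= n + 1)%nat -> z j < z k.
Proof.
intros (_ & _ & Hz & _) [Hjk Hk].
induction Hjk as [|k Hjk IH].
- replace (S j) with (j + 1)%nat by lia; apply Hz; lia.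
- apply Rlt_trans with (z k); [apply IH; lia|].
  replace (S k) with (k + 1)%nat by lia; apply Hz; lia.
Qed.

(** The function [u - m], set to 0 off [[-1, 1)]: a pattern leaves [u]
    undetermined there, and the cut-off makes the primitive Lipschitz on the
    whole line. *)
Definition excess (m : R) (u : R -> R) (x : R) : R :=
  if Rlt_dec x (-1) then 0 else if Rlt_dec x 1 then u x - m else 0.

Lemma excess_in (m : R) (u : R -> R) (x : R) : -1 <= x < 1 ->
  excess m u x = u x - m.
Proof.
intros Hx; unfold excess.
destruct (Rlt_dec x (-1)); [lra|]; destruct (Rlt_dec x 1); lra.
Qed.

Lemma excess_bound (m : R) (n : nat) (z : nat -> R) (u : R -> R) (x : R) :
  -1 < m < 1 -> is_pattern n z u -> Rabs (excess m u x) <= 2.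
Proof.
intros Hm Hp; destruct (Rle_dec (-1) x) as [Hl|Hl];
  [destruct (Rlt_dec x 1) as [Hr|Hr]|].
- destruct (pattern_covers n z u x Hp (conj Hl Hr)) as (k & Hk & Hkx).
  rewrite excess_in by lra.
  destruct Hp as (_ & _ & _ & Hu); rewrite (Hu k x Hk Hkx).
  assert (H1 := pow_1_abs (k + 1)).
  apply Rle_trans with (1 := Rabs_triang _ _).
  rewrite H1, Rabs_Ropp; assert (Rabs m < 1) by (apply Rabs_def1; lra); lra.
- unfold excess; destruct (Rlt_dec x (-1)); [lra|]; destruct (Rlt_dec x 1); [lra|].
  rewrite Rabs_R0; lra.
- unfold excess; destruct (Rlt_dec x (-1)); [|lra].
  rewrite Rabs_R0; lra.
Qed.

(** The test function is the primitive [psi] of [w = flux v + W] vanishing at the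
    north pole.  As [W] vanishes at the south pole, integration by parts has no
    boundary terms, and the weak equation becomes
    [int flux v * w = - int W * w], that is [int w^2 = 0]. *)
Lemma pattern_first_integral (m : R) (n : nat) (z : nat -> R) (u v : R -> R) :
  -1 < m < 1 -> is_pattern n z u -> solves_poisson m (axisym u) (axisym v) ->
  exists W : R -> R,
    (forall a b, Rabs (W b - W a) <= 2 * Rabs (b - a)) /\
    forall x, -1 < x < 1 -> (1 - x ^ 2) * Derive v x = - W x.
Proof.
intros Hm Hp Hv.
assert (Hp' := Hp); destruct Hp' as (Hz0 & Hz1 & Hz & Hu).
set (f := excess m u).
assert (Hle : forall k, (k <= n)%nat -> z k <= z (k + 1)%nat)
  by (intros; now apply Rlt_le, Hz).
assert (Hf : forall k x, (k <= n)%nat -> z k < x < z (k + 1)%nat ->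
  f x = (-1) ^ (k + 1) - m).
{ intros k x Hk Hx; unfold f.
  assert (-1 <= z k).
  { rewrite <- Hz0; destruct k as [|k]; [lra|].
    apply Rlt_le, (pattern_lt n z u); auto; lia. }
  assert (z (k + 1)%nat <= 1).
  { rewrite <- Hz1; destruct (Nat.eq_dec k n) as [->|Hkn]; [lra|].
    apply Rlt_le, (pattern_lt n z u); auto; lia. }
  rewrite excess_in, (Hu k x) by (auto; lra); reflexivity. }
assert (Hex : forall a b, ex_RInt f a b).
{ apply (ex_RInt_cutoff f (-1) 1); [lra| | |].
  - intros x Hx; unfold f, excess; destruct (Rlt_dec x (-1)); lra.
  - intros x Hx; unfold f, excess; destruct (Rlt_dec x (-1)); [lra|].
    destruct (Rlt_dec x 1); lra.
  - rewrite <- Hz0, <- Hz1. apply (ex_RInt_step f z _ n Hle Hf); lia. }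
set (W := fun x => RInt f (-1) x).
assert (HW : forall a b, Rabs (W b - W a) <= 2 * Rabs (b - a)).
{ apply RInt_lipschitz; auto; intros x; now apply (excess_bound m n z). }
assert (HWc := lipschitz_continuous W 2 HW).
assert (HWf : forall a b, is_RInt f a b (W b - W a)).
{ intros a b.
  assert (E := RInt_Chasles f (-1) a b (Hex _ _) (Hex _ _)).
  change (W a + RInt f a b = W b) in E.
  replace (W b - W a) with (RInt f a b) by lra.
  now apply (RInt_correct (V := R_CompleteNormedModule)). }
exists W; split; auto.
assert (HC := proj1 Hv).
set (w := fun x => flux v x + W x).
assert (Hw : forall x, continuous w x).
{ intros x; apply continuous_plus_R; auto; now apply continuous_flux. }
set (psi := fun x => RInt w 1 x).
assert (Hpsi : forall x, is_derive psi x (w x)).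
{ intros x; apply (is_derive_RInt w psi 1); auto.
  apply filter_forall; intros y.
  apply (RInt_correct (V := R_CompleteNormedModule)); now apply ex_RInt_continuous_all. }
assert (Hparts := is_RInt_step_by_parts f W psi w z _ n Hle Hf HWf Hpsi Hw
  (n + 1) (le_n _)).
assert (Hpsi1 : psi 1 = 0) by apply (RInt_point 1 w).
assert (HW1 : W (-1) = 0) by apply (RInt_point (-1) f).
rewrite Hz0, Hz1, Hpsi1, HW1 in Hparts.
replace (W 1 * 0 - 0 * psi (-1)) with 0 in Hparts by ring.
assert (HWw : ex_RInt (fun x => W x * w x) (-1) 1).
{ apply ex_RInt_continuous_all; intros; now apply continuous_mult_R. }
assert (Hgw : ex_RInt (fun x => flux v x * w x) (-1) 1).
{ apply ex_RInt_continuous_all; intros; apply continuous_mult_R; auto.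
  now apply continuous_flux. }
assert (Hfpsi : is_RInt (fun x => (u x - m) * psi x) (-1) 1
  (- RInt (fun x => W x * w x) (-1) 1)).
{ replace (- RInt (fun x => W x * w x) (-1) 1) with
    (minus 0 (RInt (fun x => W x * w x) (-1) 1)) by (rewrite <- Rminus_0_l; reflexivity).
  apply is_RInt_ext with (fun x => minus (f x * psi x + W x * w x) (W x * w x)).
  - rewrite Rmin_left, Rmax_right by lra; intros x Hx.
    change (f x * psi x + W x * w x - W x * w x = (u x - m) * psi x).
    unfold f; rewrite excess_in by lra; ring.
  - apply (is_RInt_minus (V := R_NormedModule) _ _ _ _ _ _ Hparts).
    now apply (RInt_correct (V := R_CompleteNormedModule)). }
assert (E := zonal_weak_equation m u v psi w Hv Hpsi Hw (ex_intro _ _ Hfpsi)).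
rewrite (is_RInt_unique (V := R_CompleteNormedModule) _ _ _ _ Hfpsi) in E.
assert (H0 : RInt (fun x => w x * w x) (-1) 1 = 0).
{ rewrite (RInt_ext _ (fun x => plus (flux v x * w x) (W x * w x))).
  - refine (eq_trans (RInt_plus (V := R_CompleteNormedModule) _ _ _ _ Hgw HWw) _).
    rewrite E; apply Rplus_opp_l.
  - intros x _; apply Rmult_plus_distr_r. }
intros x Hx; rewrite <- flux_eq by auto.
assert (Hwx := RInt_sqr_eq0 w (-1) 1 Hw H0 x Hx); unfold w in Hwx; lra.
Qed.

(** * Spacing of the interfaces *)

Lemma is_derive_parallel_curvature (x : R) : -1 < x < 1 ->
  is_derive (fun t => t / sqrt (1 - t ^ 2)) x (/ ((1 - x ^ 2) * sqrt (1 - x ^ 2))).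
Proof.
intros Hx.
assert (H0 : 0 < 1 - x ^ 2) by nra.
assert (Hs := sqrt_lt_R0 _ H0); assert (Hq := sqrt_sqrt _ (Rlt_le _ _ H0)).
auto_derive; replace (1 + - (x * (x * 1))) with (1 - x ^ 2) by ring.
- repeat split; lra.
- set (s := sqrt (1 - x ^ 2)) in *; rewrite <- Hq.
  field_simplify_eq; [|lra]. nra.
Qed.

(** Rolle's theorem for [s * x / sqrt (1 - x^2) + 4 gamma v(x)], the critical
    point equation being multiplied by [1 - xi^2]. *)
Lemma critical_flux (gamma : R) (s lambda a b : R) (v W : R -> R) :
  (forall x, -1 < x < 1 -> ex_derive v x) ->
  (forall x, -1 < x < 1 -> (1 - x ^ 2) * Derive v x = - W x) ->
  -1 < a -> a < b -> b < 1 ->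
  (forall x, x = a \/ x = b ->
    s * (x / sqrt (1 - x ^ 2)) + 4 * gamma * v x = lambda) ->
  exists xi, a <= xi <= b /\ s / sqrt (1 - xi ^ 2) = 4 * gamma * W xi.
Proof.
intros Hv HW Ha Hab Hb Hcrit.
set (G := fun x => s * (x / sqrt (1 - x ^ 2)) + 4 * gamma * v x).
set (dG := fun x => s * / ((1 - x ^ 2) * sqrt (1 - x ^ 2)) + 4 * gamma * Derive v x).
assert (HG : forall x, -1 < x < 1 -> is_derive G x (dG x)).
{ intros x Hx; apply (is_derive_plus (V := R_NormedModule)).
  - apply is_derive_scal, is_derive_parallel_curvature, Hx.
  - now apply is_derive_scal, Derive_correct, Hv. }
destruct (MVT_gen G a b dG) as (xi & Hxi & E).
- rewrite Rmin_left, Rmax_right by lra; intros x Hx; apply HG; lra.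
- rewrite Rmin_left, Rmax_right by lra; intros x Hx.
  apply continuity_pt_filterlim.
  apply (ex_derive_continuous (V := R_NormedModule)).
  exists (dG x); apply HG; lra.
- rewrite Rmin_left, Rmax_right in Hxi by lra.
  exists xi; split; auto.
  unfold G in E; rewrite !Hcrit in E by auto.
  assert (E0 : dG xi = 0).
  { destruct (Rmult_integral (dG xi) (b - a)); lra. }
  assert (Hp : 0 < 1 - xi ^ 2) by nra.
  assert (Hs := sqrt_lt_R0 _ Hp).
  unfold dG in E0.
  assert (E1 := HW xi ltac:(lra)).
  replace (s / sqrt (1 - xi ^ 2)) with
    ((1 - xi ^ 2) * (s * / ((1 - xi ^ 2) * sqrt (1 - xi ^ 2)))) by (field; lra).
  replace (W xi) with (- ((1 - xi ^ 2) * Derive v xi)) by lra.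
  replace (s * / ((1 - xi ^ 2) * sqrt (1 - xi ^ 2))) with (- (4 * gamma * Derive v xi))
    by lra.
  ring.
Qed.

(** Since [1 / sqrt (1 - x^2) >= 1], the values of [4 gamma W] at [a] and [b]
    differ by at least 2; on the other hand, they differ by at most
    [8 gamma |b - a|]. *)
Lemma opposite_flux_gap (gamma s a b : R) (W : R -> R) :
  0 < gamma -> Rabs s = 1 -> -1 < a < 1 -> -1 < b < 1 ->
  (forall a b, Rabs (W b - W a) <= 2 * Rabs (b - a)) ->
  s / sqrt (1 - a ^ 2) = 4 * gamma * W a ->
  - s / sqrt (1 - b ^ 2) = 4 * gamma * W b ->
  1 <= 4 * gamma * Rabs (b - a).
Proof.
intros Hg Hs Ha Hb HW Ea Eb.
assert (Hge : forall x, -1 < x < 1 -> 1 <= / sqrt (1 - x ^ 2)).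
{ intros x Hx.
  assert (H0 : 0 < sqrt (1 - x ^ 2)) by (apply sqrt_lt_R0; nra).
  rewrite <- Rinv_1 at 1; apply Rinv_le_contravar; auto.
  rewrite <- sqrt_1 at 2; apply sqrt_le_1_alt; nra. }
assert (H1 := Hge a Ha); assert (H2 := Hge b Hb).
assert (E : 4 * gamma * (W b - W a) = - s * (/ sqrt (1 - a ^ 2) + / sqrt (1 - b ^ 2))).
{ rewrite Rmult_minus_distr_l, <- Ea, <- Eb; unfold Rdiv; ring. }
assert (E' := f_equal Rabs E).
rewrite !Rabs_mult, Rabs_Ropp, Hs, (Rabs_pos_eq 4), (Rabs_pos_eq gamma) in E' by lra.
rewrite (Rabs_pos_eq (/ _ + / _)) in E' by lra.
assert (H := HW a b); nra.
Qed.

(** Three gaps are needed because the two Rolle points, between [z k] and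
    [z (k + 2)] and between [z (k + 1)] and [z (k + 3)], are located only up to
    these intervals. *)
Lemma three_interface_gap (gamma m : R) (n : nat) (z : nat -> R) (u : R -> R) (k : nat) :
  -1 < m < 1 -> 0 < gamma -> is_pattern n z u -> is_critical gamma m n z u ->
  (1 <= k)%nat -> (k + 3 <= n)%nat ->
  1 <= 4 * gamma * (z (k + 3)%nat - z k).
Proof.
intros Hm Hg Hp (v & Hv & lambda & Hcrit) Hk1 Hk3.
destruct (pattern_first_integral m n z u v Hm Hp Hv) as (W & HL & HW).
assert (Hlt := fun i j => pattern_lt n z u i j Hp).
assert (Hd : forall x, -1 < x < 1 -> ex_derive v x).
{ intros; apply ex_derive_profile; auto; apply Hv. }
assert (Hxi : forall j, (1 <= j)%nat -> (j + 2 <= n)%nat ->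
  exists xi, z j <= xi <= z (j + 2)%nat /\
    (-1) ^ (j + 1) / sqrt (1 - xi ^ 2) = 4 * gamma * W xi).
{ intros j Hj1 Hj2; apply (critical_flux gamma _ lambda _ _ v); auto.
  - rewrite <- (proj1 Hp); apply Hlt; lia.
  - apply Hlt; lia.
  - rewrite <- (proj1 (proj2 Hp)); apply Hlt; lia.
  - intros x [->| ->].
    + apply Hcrit; lia.
    + rewrite <- (Hcrit (j + 2)%nat) by lia; unfold geodesic_curvature.
      replace (j + 2 + 1)%nat with (S (S (j + 1))) by lia; simpl; ring. }
destruct (Hxi k) as (a & Ha & Ea); [lia..|].
destruct (Hxi (k + 1)%nat) as (b & Hb & Eb); [lia..|].
replace (k + 1 + 2)%nat with (k + 3)%nat in Hb by lia.
replace ((-1) ^ (k + 1 + 1)) with (- (-1) ^ (k + 1)) in Eb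
  by (replace (k + 1 + 1)%nat with (S (k + 1)) by lia; simpl; ring).
assert (H1 := Hlt 0%nat k ltac:(lia)); rewrite (proj1 Hp) in H1.
assert (H2 := Hlt (k + 3)%nat (n + 1)%nat ltac:(lia)).
rewrite (proj1 (proj2 Hp)) in H2.
assert (H3 := Hlt k (k + 1)%nat ltac:(lia)).
assert (H4 := Hlt (k + 2)%nat (k + 3)%nat ltac:(lia)).
assert (H := opposite_flux_gap gamma _ a b W Hg (pow_1_abs (k + 1))
  ltac:(lra) ltac:(lra) HL Ea Eb).
apply Rle_trans with (1 := H); apply Rmult_le_compat_l; [lra|].
apply Rabs_le; lra.
Qed.

(** * The bound on the number of interfaces *)

Theorem proposition5p1 (m : R) (hm : -1 < m < 1) (gamma : R) (hgamma : 0 < gamma) :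
  exists N : nat, forall (n : nat) (z : nat -> R) (u : R -> R),
    is_pattern n z u ->
    mass (axisym u) = m ->
    is_critical gamma m n z u ->
    (n <= N)%nat.
Proof.
destruct (INR_unbounded (8 * gamma)) as [J HJ].
(* With more than 3 J interfaces, J adjacent triple gaps of length at least
   1 / (4 gamma) would lie inside (-1, 1), although J > 8 gamma. *)
exists (3 * J)%nat; intros n z u Hp _ Hcrit.
destruct (Nat.le_gt_cases n (3 * J)) as [|Hn]; auto; exfalso.
assert (H : forall j, (j <= J)%nat ->
  INR j <= 4 * gamma * (z (3 * j + 1)%nat - z 1%nat)).
{ induction j as [|j IH]; intros Hj.
  - simpl; lra.
  - assert (Hgap := three_interface_gap gamma m n z u (3 * j + 1) hm hgamma Hp Hcrit
      ltac:(lia) ltac:(lia)).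
    replace (3 * j + 1 + 3)%nat with (3 * S j + 1)%nat in Hgap by lia.
    rewrite S_INR; assert (IH' := IH ltac:(lia)); lra. }
assert (HJ' := H J (le_n J)).
assert (H1 := pattern_lt n z u 0 1 Hp ltac:(lia)).
assert (H2 := pattern_lt n z u (3 * J + 1) (n + 1) Hp ltac:(lia)).
rewrite (proj1 Hp) in H1; rewrite (proj1 (proj2 Hp)) in H2; nra.
Qed.
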